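(* Let $\mathcal A$ be a countable structure. The following are equivalent: (1) There is a continuous group isomorphism between $\mathrm{Aut}(\mathcal A)$ and $S_\infty$. (2) There are $n\in\omega$, an $\mathcal L_{\omega_1\omega}$-definable (without parameters) set $D\subseteq A^n$, and an $\mathcal L_{\omega_1\omega}$-definable equivalence relation $E\subseteq D^2$ with infinitely many equivalence classes, such that the $E$-equivalence classes are absolutely indiscernible (every permutation of the $E$-classes extends to an automorphism of $\mathcal A$), and every other element is definable from this set: if we add to $\mathcal A$ relations naming each of the $E$-equivalence classes, then every element of the expanded structure is $\mathcal L_{\omega_1\omega}$-definable.
   Context: $\mathcal A$ has domain $\omega$; $S_\infty$ is the group of permutations of $\omega$; automorphism groups carry the topology of pointwise convergence. An automorphism $g$ of $\mathcal A$ extends a permutation $h$ of the $E$-classes if $g$, acting coordinatewise on $A^n$, maps each $E$-class $C$ onto $h(C)$. *)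

(* Defs.v *)
From HB Require Import structures.
From mathcomp Require Import all_boot all_order all_algebra.
From mathcomp Require Import all_classical all_reals all_analysis.

Set Implicit Arguments.
Unset Strict Implicit.
Unset Printing Implicit Defensive.

Local Open Scope classical_set_scope.

Record signature := Signature {
  fsym : Type;
  rsym : Type;
  farity : fsym -> nat;
  rarity : rsym -> nat }.

(* Structures with domain omega; constants are function symbols of arity 0. *)
Record structure (L : signature) := Structure {
  finterp : forall f : fsym L, (farity f).-tuple nat -> nat;
  rinterp : forall r : rsym L, set ((rarity r).-tuple nat) }.

Inductive term (L : signature) (n : nat) : Type :=
| Var of 'I_n
| App (f : fsym L) of ('I_(farity f) -> term L n).

(* [formula L n] is the type of L_{omega_1 omega} formulas whose free variables
   are among x_0, ..., x_{n-1}. Quantifiers bind de Bruijn style: the bound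
   variable is x_0 of the matrix and the other indices are shifted by one.
   A countable set of formulas is given by an enumeration, possibly with
   repetitions. *)
Inductive formula (L : signature) : nat -> Type :=
| Eq n of term L n & term L n : formula L n
| Rel n (r : rsym L) of ('I_(rarity r) -> term L n) : formula L n
| Neg n of formula L n : formula L n
| Conj n of (nat -> formula L n) : formula L n
| Disj n of (nat -> formula L n) : formula L n
| All n of formula L n.+1 : formula L n
| Ex n of formula L n.+1 : formula L n.

Fixpoint term_eval (L : signature) (A : structure L) (n : nat) (v : n.-tuple nat)
    (t : term L n) : nat :=
  match t with
  | Var i => tnth v i
  | App f ts => finterp A [tuple term_eval A v (ts i) | i < farity f]
  end.

Fixpoint sat (L : signature) (A : structure L) (n : nat) (phi : formula L n) :
    n.-tuple nat -> Prop :=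
  match phi in formula _ n return n.-tuple nat -> Prop with
  | Eq _ s t => fun v => term_eval A v s = term_eval A v t
  | Rel _ r ts => fun v => rinterp A [tuple term_eval A v (ts i) | i < rarity r]
  | Neg _ psi => fun v => ~ sat A psi v
  | Conj _ psi => fun v => forall k, sat A (psi k) v
  | Disj _ psi => fun v => exists k, sat A (psi k) v
  | All _ psi => fun v => forall a : nat, sat A psi [tuple of a :: v]
  | Ex _ psi => fun v => exists a : nat, sat A psi [tuple of a :: v]
  end.

(* Parameter-free L_{omega_1 omega}-definability. *)
Definition definable_set (L : signature) (A : structure L) (n : nat)
    (D : set (n.-tuple nat)) : Prop :=
  exists phi : formula L n, D = [set v | sat A phi v].

Definition definable_rel (L : signature) (A : structure L) (n : nat)
    (E : set (n.-tuple nat * n.-tuple nat)) : Prop :=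
  exists phi : formula L (n + n),
    E = [set uv | sat A phi (cat_tuple uv.1 uv.2)].

Definition definable_elt (L : signature) (A : structure L) (a : nat) : Prop :=
  definable_set A [set [tuple a]].

(* The symmetric group S_infty. As a set_type over {ptws nat -> nat} (nat being
   discrete) it carries the topology of pointwise convergence; the product is
   composition. *)
Definition Sinf : Type := set_type [set g : {ptws nat -> nat} | bijective g].
HB.instance Definition _ := Topological.on Sinf.
HB.instance Definition _ := Choice.on Sinf.

Definition sinf_fun (g : Sinf) : nat -> nat := set_val g.
Coercion sinf_fun : Sinf >-> Funclass.

Lemma sinf_bij (g : Sinf) : bijective g.
Proof. exact: set_mem (valP g). Qed.

Lemma sinf_inj : injective sinf_fun.
Proof. exact: val_inj. Qed.

Definition mkSinf (g : nat -> nat) (bg : bijective g) : Sinf :=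
  @exist _ _ (g : {ptws nat -> nat}) (mem_set bg).

Definition sinf_one : Sinf := mkSinf (@inv_bij _ id (fun=> erefl)).

Definition sinf_mul (g h : Sinf) : Sinf :=
  mkSinf (bij_comp (sinf_bij g) (sinf_bij h)).

Lemma sinf_inv_subproof (g : Sinf) :
  exists2 h : nat -> nat, bijective h & cancel h g /\ cancel g h.
Proof. by case: (sinf_bij g) => h gK hK; exists h => //; exists g. Qed.

Definition sinf_inv (g : Sinf) : Sinf :=
  mkSinf (s2valP (cid2 (sinf_inv_subproof g))).

Lemma sinf_mulA : associative sinf_mul.
Proof. by move=> f g h; exact: sinf_inj. Qed.

Lemma sinf_mul1 : left_id sinf_one sinf_mul.
Proof. by move=> g; exact: sinf_inj. Qed.

Lemma sinf_mulr1 : right_id sinf_one sinf_mul.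
Proof. by move=> g; exact: sinf_inj. Qed.

Lemma sinf_mulV : left_inverse sinf_one sinf_inv sinf_mul.
Proof.
move=> g; apply: sinf_inj; apply/funext => x.
exact: (s2valP' (cid2 (sinf_inv_subproof g))).2.
Qed.

Lemma sinf_mulrV : right_inverse sinf_one sinf_inv sinf_mul.
Proof.
move=> g; apply: sinf_inj; apply/funext => x.
exact: (s2valP' (cid2 (sinf_inv_subproof g))).1.
Qed.

HB.instance Definition _ := isGroup.Build Sinf
  sinf_mulA sinf_mul1 sinf_mulr1 sinf_mulV sinf_mulrV.

Definition tact (g : nat -> nat) (n : nat) (v : n.-tuple nat) : n.-tuple nat :=
  [tuple of map g v].

Definition automorphism (L : signature) (A : structure L) : set Sinf :=
  [set g | (forall (f : fsym L) (v : (farity f).-tuple nat),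
              g (finterp A v) = finterp A (tact g v))
        /\ (forall (r : rsym L) (v : (rarity r).-tuple nat),
              rinterp A v <-> rinterp A (tact g v))].

Definition AutGroup (L : signature) (A : structure L) : Type :=
  set_type (automorphism A).

Section AutGroupTheory.
Variables (L : signature) (A : structure L).

HB.instance Definition _ := Topological.on (AutGroup A).
HB.instance Definition _ := SubChoice.on (AutGroup A).

Lemma tact_id n (v : n.-tuple nat) : tact id v = v.
Proof. by apply: val_inj; rewrite /= map_id. Qed.

Lemma tact_comp (g h : nat -> nat) n (v : n.-tuple nat) :
  tact (g \o h) v = tact g (tact h v).
Proof. by apply: val_inj; rewrite /= map_comp. Qed.

Lemma sinfM (g h : Sinf) : sinf_fun (g * h)%g = g \o h.
Proof. by []. Qed.

Lemma sinf1 : sinf_fun 1%g = id.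
Proof. by []. Qed.

Lemma sinfKV (g : Sinf) : sinf_fun g \o sinf_fun g^-1%g = id.
Proof. by rewrite -sinfM mulgV. Qed.

Lemma sinfVK (g : Sinf) : sinf_fun g^-1%g \o sinf_fun g = id.
Proof. by rewrite -sinfM mulVg. Qed.

Lemma automorphism_group_closed :
  group_closed (fun g : Sinf => g \in automorphism A).
Proof.
split.
  by apply: mem_set; split=> [f|r] v; rewrite sinf1 tact_id.
move=> /= g' h'; move: (g' : Sinf) (h' : Sinf) => g h.
move=> /set_mem[gf gr] /set_mem[hf hr]; apply: mem_set.
split=> [f|r] v; rewrite sinfM tact_comp.
  rewrite -gf /=; congr (g _).
  have E k (w : k.-tuple nat) : tact h (tact (h^-1%g : Sinf) w) = w by rewrite -tact_comp sinfKV tact_id.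
  rewrite -{1}(E _ v) -hf.
  exact: (congr1 (fun k => k _) (sinfVK h)).
rewrite -gr (hr _ (tact (h^-1%g : Sinf) v)).
by rewrite -tact_comp sinfKV tact_id.
Qed.

HB.instance Definition _ :=
  SubChoice_isSubGroup.Build Sinf _ (AutGroup A) automorphism_group_closed.

End AutGroupTheory.

Record equivalence_on (T : Type) (D : set T) (E : set (T * T)) : Prop :=
  EquivalenceOn {
    eqv_sub : E `<=` D `*` D;
    eqv_refl : forall u, D u -> E (u, u);
    eqv_sym : forall u v, E (u, v) -> E (v, u);
    eqv_trans : forall u v w, E (u, v) -> E (v, w) -> E (u, w) }.

Definition eqv_classes (T : Type) (D : set T) (E : set (T * T)) :
    set (set T) :=
  [set C | exists2 u, D u & C = [set v | E (u, v)]].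

Definition extends (n : nat) (K : set (set (n.-tuple nat))) (g : Sinf)
    (h : set_type K -> set_type K) : Prop :=
  forall C : set_type K, [set tact g v | v in set_val C] = set_val (h C).

Definition absolutely_indiscernible (L : signature) (A : structure L)
    (n : nat) (K : set (set (n.-tuple nat))) : Prop :=
  forall h : set_type K -> set_type K, bijective h ->
    exists2 g : Sinf, automorphism A g & extends g h.

(* The expansion of A by an n-ary relation naming each member of K. *)
Section Expansion.
Variables (L : signature) (A : structure L).
Variables (n : nat) (K : set (set (n.-tuple nat))).

Definition expansion_sig : signature :=
  @Signature (fsym L) (rsym L + set_type K)%type (@farity L)
    (fun r => match r with inl r => rarity r | inr _ => n end).

Definition expansion : structure expansion_sig :=
  @Structure expansion_sig (@finterp L A)
    (fun r => match r return set ((@rarity expansion_sig r).-tuple nat) with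
              | inl r => rinterp A (r := r)
              | inr C => set_val C
              end).

End Expansion.

(* Main.v *)
(* Scott: two tuples with the same L_{omega_1 omega} type are conjugate by an
   automorphism (back and forth), so a set of tuples is definable as soon as it
   is invariant. This needs no countability of the signature: a failing
   extension step is witnessed by one formula per element of the domain.
   If the classes of E are absolutely indiscernible and name every element, the
   action on the classes identifies the automorphism group with S_infty.
   Conversely, the elements sent by Phi to the stabiliser of 0 form an open
   subgroup, which contains the pointwise stabiliser of some tuple a; D is the
   orbit of a, and g a, h a are E-equivalent when Phi g and Phi h agree at 0. *)
From HB Require Import structures.
Require Import Defs.
From mathcomp Require Import all_boot all_order all_algebra.
From mathcomp Require Import all_classical all_reals all_analysis.

Set Implicit Arguments.
Unset Strict Implicit.
Unset Printing Implicit Defensive.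

Local Open Scope classical_set_scope.

(** * Invariance of infinitary formulas under automorphisms *)

Lemma term_eval_aut (L : signature) (A : structure L) (g : Sinf) n
    (v : n.-tuple nat) (t : term L n) :
  automorphism A g -> term_eval A (tact g v) t = g (term_eval A v t).
Proof.
move=> [gf _]; elim: t => [i|f ts IH] /=; first by rewrite tnth_map.
rewrite gf; congr finterp; apply: eq_from_tnth => i.
by rewrite [RHS]tnth_map !tnth_mktuple IH.
Qed.

(** Induction on the formula: equality needs [g] injective, and the quantifiers need [g] surjective,
    so that any value can be written as [g (g' a)]. *)
Lemma sat_aut (L : signature) (A : structure L) (g : Sinf) n
    (phi : formula L n) (v : n.-tuple nat) :
  automorphism A g -> sat A phi (tact g v) <-> sat A phi v.
Proof.
move=> gA; have [g' gK g'K] := sinf_bij g.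
have tactE k a (w : k.-tuple nat) :
    [tuple of g a :: tact g w] = tact g [tuple of a :: w] by exact: val_inj.
elim: phi v => {n} /=.
- move=> n s t v; rewrite !term_eval_aut //.
  by split=> [/(can_inj gK)|->].
- move=> n r ts v; rewrite [X in _ <-> X](gA.2 r).
  set x := [tuple _ | i < _]; set y := tact _ _; suff -> : x = y by [].
  apply: eq_from_tnth => i.
  by rewrite [RHS]tnth_map !tnth_mktuple term_eval_aut.
- by move=> n psi IH v; rewrite IH.
- by move=> n psi IH v; split=> h k; apply/IH; exact: h.
- by move=> n psi IH v; split=> -[k /IH]; exists k.
- move=> n psi IH v; split=> h a; first by apply/IH; rewrite -tactE; exact: h.
  by rewrite -(g'K a) tactE; apply/IH; exact: h.
- move=> n psi IH v; split=> -[a].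
    by rewrite -(g'K a) tactE => /IH; exists (g' a).
  by move=> /IH; rewrite -tactE; exists (g a).
Qed.

(** * Infinitary types and the back-and-forth construction *)

(** One implication is enough, because formulas are closed under negation. *)
Definition same_type (L : signature) (A : structure L) n (u v : n.-tuple nat) :=
  forall phi : formula L n, sat A phi u -> sat A phi v.

Lemma same_type_sym (L : signature) (A : structure L) n (u v : n.-tuple nat) :
  same_type A u v -> same_type A v u.
Proof. by move=> uv phi; apply: contraPP; exact: (uv (Neg phi)). Qed.

(** Serves to move between tuple types whose lengths are equal but not convertible. *)
Lemma same_type_val (L : signature) (A : structure L) n m
    (u v : n.-tuple nat) (u' v' : m.-tuple nat) :
  same_type A u v -> val u = val u' -> val v = val v' -> same_type A u' v'.
Proof.
move=> + uu' vv'; have nm : n = m by rewrite -(size_tuple u) uu' size_tuple.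
by case: m / nm u' v' uu' vv' => u' v' /val_inj -> /val_inj ->.
Qed.

(** If every [d] failed, each would have a separating formula [phi d]. As the domain is countable,
    [Ex (Conj phi)] is a formula; it holds at [u], hence at [v], and any witness [d] contradicts the
    choice of [phi d]. *)
Lemma same_type_extend (L : signature) (A : structure L) n
    (u v : n.-tuple nat) (c : nat) : same_type A u v ->
  exists d, same_type A [tuple of c :: u] [tuple of d :: v].
Proof.
move=> uv; apply: contrapT => /forallNP nd.
have {}nd d : exists phi : formula L n.+1,
    sat A phi [tuple of c :: u] /\ ~ sat A phi [tuple of d :: v].
  by have /existsNP[phi /not_implyP] := nd d; exists phi.
have [phi phiP] := choice nd.
have [|d dP] := uv (Ex (Conj phi)); last by apply: (phiP d).2; exact: dP.
by exists c => k; exact: (phiP k).1.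
Qed.

(* A finite partial map, given by its list of pairs, that is elementary for
   infinitary formulas. *)
Definition elementary (L : signature) (A : structure L) (s : seq (nat * nat)) :=
  same_type A (map_tuple fst (in_tuple s)) (map_tuple snd (in_tuple s)).

(** One extension step puts [k] in the domain; by symmetry of types, a second one puts [k] in the
    range. *)
Lemma elementary_back_forth (L : signature) (A : structure L) s k :
  elementary A s ->
  exists c d, elementary A [:: (c, k), (k, d) & s].
Proof.
move=> /(same_type_extend k)[d] /same_type_sym /(same_type_extend k)[c].
by move=> /same_type_sym sA; exists c, d; exact: same_type_val sA _ _.
Qed.

(** Common core of the cases of equality, relations and functions. The entries of [v] may sit
    anywhere in [s], so [P] has to be expressible after every substitution [f] of variables. *)
Lemma elementary_atom (L : signature) (A : structure L) s k
    (P : k.-tuple nat -> Prop) (v w : k.-tuple nat) :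
  elementary A s -> (forall i, (tnth v i, tnth w i) \in s) ->
  (forall n (f : 'I_k -> 'I_n), exists phi : formula L n,
     forall u : n.-tuple nat, sat A phi u <-> P [tuple tnth u (f i) | i < k]) ->
  P v <-> P w.
Proof.
move=> sA vw Patom.
have {vw}/fin_all_exists[f fP] i : exists j : 'I_(size s),
    tnth (in_tuple s) j = (tnth v i, tnth w i).
  by have /seq_tnthP[j ->] := vw i; exists j.
have [phi phiP] := Patom _ f.
set u1 := map_tuple fst (in_tuple s); set u2 := map_tuple snd (in_tuple s).
have -> : v = [tuple tnth u1 (f i) | i < k].
  by apply: eq_from_tnth => i; rewrite tnth_mktuple tnth_map fP.
have -> : w = [tuple tnth u2 (f i) | i < k].
  by apply: eq_from_tnth => i; rewrite tnth_mktuple tnth_map fP.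
rewrite -!phiP; split; [exact: sA | exact: (same_type_sym sA)].
Qed.

(** Along a chain of such maps, the two directions make the union single-valued and injective. *)
Lemma elementary_eq (L : signature) (A : structure L) s a b a' b' :
  elementary A s -> (a, b) \in s -> (a', b') \in s -> a = a' <-> b = b'.
Proof.
move=> sA ab ab'.
pose P (u : 2.-tuple nat) := tnth u ord0 = tnth u (lift ord0 ord0).
apply: (@elementary_atom _ _ _ _ P [tuple a; a'] [tuple b; b'] sA).
  by move=> i; rewrite !(tnth_nth 0); case: i => -[|[|]].
move=> n f; exists (Eq (Var _ (f ord0)) (Var _ (f (lift ord0 ord0)))) => u.
by rewrite /P !tnth_mktuple.
Qed.

Lemma elementary_rsym (L : signature) (A : structure L) s (r : rsym L)
    (v w : (rarity r).-tuple nat) :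
  elementary A s -> (forall i, (tnth v i, tnth w i) \in s) ->
  rinterp A v <-> rinterp A w.
Proof.
move=> sA vw; apply: (elementary_atom sA vw) => n f.
by exists (@Rel L n r (fun i => Var _ (f i))).
Qed.

(** The graph of [f] is treated as a relation with one more argument, the value coming first. *)
Lemma elementary_fsym (L : signature) (A : structure L) s (f : Defs.fsym L)
    (v w : (farity f).-tuple nat) b :
  elementary A s -> (forall i, (tnth v i, tnth w i) \in s) ->
  (finterp A v, b) \in s -> finterp A w = b.
Proof.
move=> sA vw fb.
pose P (u : (farity f).+1.-tuple nat) :=
  tnth u ord0 = finterp A [tuple tnth u (lift ord0 i) | i < farity f].
have Pcons c (u : (farity f).-tuple nat) :
    P [tuple of c :: u] <-> c = finterp A u.
  rewrite /P tnth0; set y := [tuple _ | i < _]; suff -> : y = u by [].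
  by apply: eq_from_tnth => i; rewrite tnth_mktuple tnthS.
symmetry; apply/Pcons.
apply: (@elementary_atom L A s _ P [tuple of finterp A v :: v]
  [tuple of b :: w] sA _ _).1.
- by move=> i; case: (unliftP ord0 i) => [j|] ->; rewrite ?tnthS ?tnth0.
- move=> n x.
  exists (Eq (Var _ (x ord0)) (App (fun i => Var _ (x (lift ord0 i))))) => u.
  rewrite /P /= tnth_mktuple; set y := [tuple _ | i < _].
  set z := [tuple _ | i < _]; suff -> : y = z by [].
  by apply: eq_from_tnth => i; rewrite !tnth_mktuple.
- exact/Pcons.
Qed.

(** A chain [S] starts from [s], and its step [k] puts [k] in both domain and range; the union is
    the graph of the automorphism. *)
Lemma elementary_aut (L : signature) (A : structure L) (s : seq (nat * nat)) :
  elementary A s ->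
  exists2 g : Sinf, automorphism A g & forall a b, (a, b) \in s -> g a = b.
Proof.
move=> sA.
have [next nextP] : exists next : nat -> seq (nat * nat) -> seq (nat * nat),
    forall k t, elementary A t -> [/\ elementary A (next k t),
      {subset t <= next k t}, exists c, (c, k) \in next k t
      & exists d, (k, d) \in next k t].
  suff /choice[F FP] : forall kt : nat * seq (nat * nat), exists t',
      elementary A kt.2 -> [/\ elementary A t', {subset kt.2 <= t'},
      exists c, (c, kt.1) \in t' & exists d, (kt.1, d) \in t'].
    by exists (fun k t => F (k, t)) => k t; exact: (FP (k, t)).
  (* The empty list is a default value for lists that are not elementary; the chain never meets
     it. *)
  move=> [k t] /=; have [tA|] := pselect (elementary A t); last by exists [::].
  have [c [d cd]] := elementary_back_forth k tA.
  exists [:: (c, k), (k, d) & t] => _; split=> //.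
  - by move=> p pt; rewrite !inE pt !orbT.
  - by exists c; rewrite !inE eqxx.
  - by exists d; rewrite !inE eqxx orbT.
pose S := fix S k := if k is k'.+1 then next k' (S k') else s.
have SA k : elementary A (S k).
  by elim: k => //= k IH; have [] := nextP k _ IH.
have Ssub j k : j <= k -> {subset S j <= S k}.
  move=> /subnK <-; elim: (k - j) => //= i IH p /IH.
  by have [_ sub _ _] := nextP (i + j) _ (SA (i + j)); exact: sub.
pose G a b := exists k, (a, b) \in S k.
have Geq a b a' b' : G a b -> G a' b' -> a = a' <-> b = b'.
  move=> [k ab] [k' ab'].
  exact: (elementary_eq (SA _) (Ssub _ _ (leq_maxl k k') _ ab)
    (Ssub _ _ (leq_maxr k k') _ ab')).
have /choice[g gP] a : exists b, G a b.
  (* The number [a] is treated in passing from [S a] to [S a.+1]. *)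
  by have [_ _ _ [b ab]] := nextP a _ (SA a); exists b, a.+1.
have /choice[g' g'P] b : exists a, G a b.
  by have [_ _ [a ab] _] := nextP b _ (SA b); exists a, b.+1.
have gb : bijective g.
  exists g' => x; first by apply/(Geq _ _ _ _ (g'P (g x)) (gP x)).
  by apply/(Geq _ _ _ _ (gP (g' x)) (g'P x)).
have gS a b : G a b -> g a = b by move=> ab; apply/(Geq _ _ _ _ (gP a) ab).
(* A tuple has finitely many entries, so one stage of the chain contains all its pairs. *)
have tactS n (v : n.-tuple nat) : exists k,
    forall i, (tnth v i, tnth (tact g v) i) \in S k.
  have /fin_all_exists[k kP] i : exists k, (tnth v i, g (tnth v i)) \in S k.
    exact: gP.
  exists (\max_i k i) => i; rewrite tnth_map.
  by apply: Ssub (kP i); exact: leq_bigmax.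
exists (mkSinf gb); last by move=> a b abs; apply: gS; exists 0.
split=> [f v|r v].
- have [k kP] := tactS _ v; have [j jP] := gP (finterp A v).
  symmetry; apply: (elementary_fsym (SA (maxn k j))) => [i|].
    by apply: Ssub (kP i); rewrite leq_maxl.
  by apply: Ssub jP; rewrite leq_maxr.
- by have [k kP] := tactS _ v; exact: elementary_rsym (SA k) kP.
Qed.

Lemma same_type_aut (L : signature) (A : structure L) n (u v : n.-tuple nat) :
  same_type A u v -> exists2 g : Sinf, automorphism A g & tact g u = v.
Proof.
move=> uv; pose s := zip u v.
have sA : elementary A s.
  apply: same_type_val uv _ _ => /=.
    by apply/esym/unzip1_zip; rewrite !size_tuple.
  by apply/esym/unzip2_zip; rewrite !size_tuple.
have [g gA gs] := elementary_aut sA; exists g => //.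
apply: eq_from_tnth => i; rewrite tnth_map; apply: gs.
apply/(nthP (0, 0)); exists i; first by rewrite size_zip !size_tuple minnn.
by rewrite nth_zip ?size_tuple // -!tnth_nth.
Qed.

(* The formula is the disjunction over [u] in [S] of the conjunction over [v]
   outside [S] of formulas separating [u] from [v]. *)
Lemma invariant_definable (L : signature) (A : structure L) n
    (S : set (n.-tuple nat)) :
  (forall g : Sinf, automorphism A g -> forall v, S v -> S (tact g v)) ->
  definable_set A S.
Proof.
move=> Sinv.
(* [e] enumerates all tuples; codes of no tuple go to the zero tuple. *)
pose e k : n.-tuple nat := odflt [tuple of nseq n 0] (unpickle k).
have eK u : e (pickle u) = u by rewrite /e pickleK.
pose top : formula L n := Ex (Eq (Var _ ord0) (Var _ ord0)).
have topP v : sat A top v by exists 0.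
have sep (uv : n.-tuple nat * n.-tuple nat) : exists chi : formula L n,
    (S uv.1 -> sat A chi uv.1) /\ (~ S uv.2 -> ~ sat A chi uv.2).
  case: uv => u v /=.
  have [Su|nSu] := pselect (S u); last first.
    by exists (Neg top); split=> [/nSu//|_]; apply; exact: topP.
  have [Sv|nSv] := pselect (S v); first by exists top.
  (* If [u] and [v] had the same type, an automorphism would carry [u] to [v], against invariance of
     [S]. *)
  suff /existsNP[chi /not_implyP[? ?]] : ~ same_type A u v by exists chi.
  by move=> /same_type_aut[g gA guv]; apply: nSv; rewrite -guv; exact: Sinv.
have {sep}[chi chiP] := choice sep.
exists (Disj (fun j => Conj (fun k => chi (e j, e k)))).
apply/seteqP; split=> v /=.
  by move=> Sv; exists (pickle v) => k; rewrite eK; exact: (chiP (v, _)).1.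
move=> [j /(_ (pickle v))]; rewrite eK; apply: contraPP.
exact: (chiP (_, v)).2.
Qed.

Lemma definable_invariant (L : signature) (A : structure L) n
    (S : set (n.-tuple nat)) (g : Sinf) v :
  definable_set A S -> automorphism A g -> S (tact g v) <-> S v.
Proof. by move=> [phi ->] gA; exact: sat_aut. Qed.

(** * Basic neighbourhoods for pointwise convergence *)

Lemma nbhs_set_type (X : topologicalType) (B : set X) (x : set_type B)
    (U : set (set_type B)) :
  nbhs x U <-> exists2 V, nbhs (set_val x) V & set_val @^-1` V `<=` U.
Proof.
split=> [|[V Vx VU]]; last first.
  by apply: filterS VU _; exact: (@initial_continuous _ _ set_val x V Vx).
move=> [_ [[V oV <-] Vx VU]]; exists V => //.
exact: open_nbhs_nbhs.
Qed.

Lemma nbhs_ptws_nat (f : {ptws nat -> nat}) (U : set {ptws nat -> nat}) :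
  nbhs f U <->
  exists n, forall g : nat -> nat, (forall i, i < n -> g i = f i) -> U g.
Proof.
pose F := filter_from [set: nat]
  (fun n => [set g : {ptws nat -> nat} | forall i, i < n -> g i = f i]).
have FF : Filter F.
  apply: filter_from_filter; first by exists 0.
  move=> i j _ _; exists (maxn i j) => // g gf.
  by split=> k ki; apply: gf; rewrite leq_max ki ?orbT.
split=> [fU|[n nU]].
  (* The filter [F] of agreement on initial segments converges to [f] at each point, so every
     neighbourhood of [f] belongs to it. *)
  suff Ff : {ptws, F --> f} by have [n _ nU] := Ff _ fU; exists n => g /nU.
  apply/pointwise_cvgP => t V Vf; exists t.+1 => // g gf /=.
  by rewrite /= gf //; exact: nbhs_singleton.
have ev t : nbhs f [set g : {ptws nat -> nat} | g t = f t].
  have /pointwise_cvgP/(_ t) : {ptws, nbhs f --> f} by [].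
  by move=> /(_ [set f t]); apply.
(* The conditions on values are intersected one coordinate at a time. *)
elim: n U nU => [|n IH] U nU.
  suff -> : U = setT by exact: filterT.
  by apply/seteqP; split=> // g _; exact: nU.
have := IH [set g | (forall i, i < n -> g i = f i)] (fun _ => id).
move=> /(filterI (ev n)); apply: filterS => g [gn gi].
by apply: nU => i; rewrite ltnS leq_eqVlt => /orP[/eqP->|/gi].
Qed.

Lemma nbhs_Sinf (f : Sinf) (U : set Sinf) :
  nbhs f U <->
  exists n, forall g : Sinf, (forall i, i < n -> g i = f i) -> U g.
Proof.
split=> [/nbhs_set_type[V /nbhs_ptws_nat[n nV] VU]|[n nU]].
  by exists n => g gf; apply: VU; exact: nV.
apply/nbhs_set_type.
exists [set g : {ptws nat -> nat} | forall i, i < n -> g i = f i].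
  by apply/nbhs_ptws_nat; exists n.
by move=> g; exact: nU.
Qed.

Lemma nbhs_AutGroup (L : signature) (A : structure L) (f : AutGroup A)
    (U : set (AutGroup A)) :
  nbhs f U <->
  exists n, forall g : AutGroup A,
    (forall i, i < n -> (\val g : Sinf) i = (\val f : Sinf) i) -> U g.
Proof.
split=> [/nbhs_set_type[V /nbhs_Sinf[n nV] VU]|[n nU]].
  by exists n => g gf; apply: VU; exact: nV.
apply/nbhs_set_type.
exists [set g : Sinf | forall i, i < n -> g i = (\val f : Sinf) i].
  by apply/nbhs_Sinf; exists n.
by move=> g; exact: nU.
Qed.

(** * Homomorphisms, enumerations, and automorphisms as functions *)

Lemma morph_multiplicative (G H : magmaType) (f : G -> H) :
  {morph f : x y / (x * y)%g} ->
  exists Phi : {multiplicative G -> H}, Phi =1 f.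
Proof.
move=> fM; pose M := isMultiplicative.Build G H f fM.
pose Phi : {multiplicative G -> H} := HB.pack f M.
by exists Phi.
Qed.

Lemma infinite_countable_bij (T : Type) (K : set T) :
  countable K -> infinite_set K -> exists e : nat -> set_type K, bijective e.
Proof.
move=> cK iK.
have /card_bijP[f fb] : ([set: nat] #= K)%card.
  by rewrite card_eq_sym; exact: eq_card_nat.
exists (f \o to_setT); apply: bij_comp fb _.
by exists val => // x; exact: val_inj.
Qed.

Definition aut_fun (L : signature) (A : structure L) (g : AutGroup A) :
  nat -> nat := (\val g : Sinf).

Lemma aut_funP (L : signature) (A : structure L) (g : AutGroup A) :
  automorphism A (\val g).
Proof. exact: set_mem (valP g). Qed.

Lemma aut_fun_inj (L : signature) (A : structure L) : injective (@aut_fun L A).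
Proof. by move=> g h /sinf_inj/val_inj. Qed.

Lemma aut_fun1 (L : signature) (A : structure L) :
  aut_fun (1%g : AutGroup A) = id.
Proof. by []. Qed.

Lemma aut_funM (L : signature) (A : structure L) (g h : AutGroup A) :
  aut_fun (g * h)%g = aut_fun g \o aut_fun h.
Proof. by []. Qed.

Lemma aut_funVK (L : signature) (A : structure L) (g : AutGroup A) :
  aut_fun g^-1%g \o aut_fun g = id.
Proof. by rewrite -aut_funM mulVg. Qed.

Lemma aut_funKV (L : signature) (A : structure L) (g : AutGroup A) :
  aut_fun g \o aut_fun g^-1%g = id.
Proof. by rewrite -aut_funM mulgV. Qed.

Lemma aut_fun_ex (L : signature) (A : structure L) (g : Sinf) :
  automorphism A g -> exists h : AutGroup A, aut_fun h = g.
Proof. by move=> gA; exists (exist _ g (mem_set gA)). Qed.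

Lemma tact_inj (g : nat -> nat) n : injective g -> injective (@tact g n).
Proof. by move=> g_inj u v /(congr1 val)/(inj_map g_inj)/val_inj. Qed.

Lemma definable_elt_fixed (L : signature) (A : structure L) a (g : Sinf) :
  definable_elt A a -> automorphism A g -> g a = a.
Proof.
move=> aA gA.
have /(congr1 (@thead _ _)) : tact g [tuple a] = [tuple a].
  by apply/(definable_invariant [tuple a] aA gA).
by [].
Qed.

Lemma expansion_automorphism (L : signature) (A : structure L) n
    (K : set (set (n.-tuple nat))) (g : Sinf) :
  automorphism (expansion A K) g <->
  automorphism A g /\ forall C, K C -> forall v, C v <-> C (tact g v).
Proof.
split=> [[gf gr]|[[gf gr] gK]].
  split; first by split=> // r v; exact: (gr (inl r)).
  by move=> C KC v; exact: (gr (inr (exist _ C (mem_set KC)))).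
split=> // -[r|C] v; first exact: gr.
exact: (gK _ (set_valP C)).
Qed.

(** * From an isomorphism to indiscernible classes *)

(* If [Phi g 0 = 0] for every [g] fixing [0, ..., n-1], then [Phi g 0] depends
   only on the image of [(0, ..., n-1)] under [g]. The classes of [E] are the
   fibres of this map on the orbit [D], so they are indexed by [nat] and [g]
   permutes them as [Phi g]. *)
Lemma iso_Sinf_indiscernible (L : signature) (A : structure L)
    (Phi : {multiplicative AutGroup A -> Sinf}) :
  bijective Phi -> continuous Phi ->
  exists (n : nat) (D : set (n.-tuple nat))
          (E : set (n.-tuple nat * n.-tuple nat)),
     [/\ definable_set A D, definable_rel A E, equivalence_on D E &
         infinite_set (eqv_classes D E)] /\
     absolutely_indiscernible A (eqv_classes D E) /\
     (forall a : nat, definable_elt (expansion A (eqv_classes D E)) a).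
Proof.
move=> [Psi PhiK PsiK] Phic.
pose F g : nat -> nat := sinf_fun (Phi g).
have Phi1 : Phi 1%g = 1%g.
  by apply: (mulgI (Phi 1%g : Sinf)); rewrite -gmulfM !mulg1.
(* Continuity at the identity, applied to the neighbourhood [p 0 = 0] of [1]. *)
have [n nP] : exists n, forall g : AutGroup A,
    (forall i, i < n -> aut_fun g i = i) -> F g 0 = 0.
  have : nbhs (Phi 1%g : Sinf) [set p : Sinf | p 0 = 0].
    apply/nbhs_Sinf; exists 1 => p /(_ 0 isT) /= ->.
    by rewrite Phi1.
  by move=> /Phic /nbhs_AutGroup[n nP]; exists n => g gn; exact: nP.
have PhiM g h k : F (g * h)%g k = F g (F h k) by rewrite /F gmulfM.
pose a : n.-tuple nat := [tuple val i | i < n].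
pose orb (g : AutGroup A) := tact (aut_fun g) a.
have orbM g h : orb (g * h)%g = tact (aut_fun g) (orb h).
  by rewrite /orb aut_funM tact_comp.
(* If [g] and [h] agree on [a], then [h^-1 * g] fixes [0, ..., n-1], so its image under [Phi] fixes
   [0]. *)
have orbPhi g h : orb g = orb h -> F g 0 = F h 0.
  move=> gh; rewrite -[g](mulVKg h) PhiM; congr (F h _); apply: nP => i ni.
  have : orb (h^-1 * g)%g = a.
    by rewrite orbM gh -orbM mulVg /orb aut_fun1 tact_id.
  move=> /(congr1 (fun t => tnth t (Ordinal ni))).
  by rewrite tnth_map tnth_mktuple.
pose C k := [set v | exists2 g, v = orb g & F g 0 = k].
have Corb g : C (F g 0) (orb g) by exists g.
have Cact g k v : C k v -> C (F g k) (tact (aut_fun g) v).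
  by move=> [h -> <-]; exists (g * h)%g; rewrite ?orbM ?PhiM.
have C_inj k k' v : C k v -> C k' v -> k = k'.
  by move=> [g -> <-] [h /orbPhi gh <-].
pose D := [set v | exists g, v = orb g].
pose E := [set uv | exists k, C k uv.1 /\ C k uv.2].
have C_ex k : exists g, F g 0 = k.
  (* By surjectivity of [Phi], the transposition of [0] and [k] has a preimage. *)
  have sw : bijective (fun i => if i == 0 then k else if i == k then 0 else i).
    apply: inv_bij => i; have [->|i0] := eqVneq i 0.
      by rewrite eqxx; case: (eqVneq k 0).
    have [->|ik] := eqVneq i k; first by rewrite eqxx.
    by rewrite (negPf i0) (negPf ik).
  by exists (Psi (mkSinf sw)); rewrite /F PsiK.
have EC k u : C k u -> [set v | E (u, v)] = C k.
  move=> ku; apply/seteqP; split=> v /=; last by exists k.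
  by move=> [k' [/(C_inj _ _ _ ku) ->]].
have KE : eqv_classes D E = range C.
  apply/seteqP; split=> X.
    by move=> [_ [g ->] ->]; exists (F g 0) => //; rewrite (EC (F g 0)).
  move=> [k _ <-]; have [g gk] := C_ex k.
  by exists (orb g); [exists g | rewrite (EC k) // -gk].
have Csetinj : injective C.
  move=> k k' kk'; have [g gk] := C_ex k.
  by apply: (C_inj _ _ (orb g)); rewrite -?kk' -gk.
exists n, D, E; split; [split|split].
- apply: invariant_definable => g /aut_fun_ex[h <-] _ [g' ->].
  by exists (h * g')%g; rewrite orbM.
(* Pairs in [E] are coded by concatenation, which loses nothing since both lengths are [n]. *)
- have [|phi phiE] := @invariant_definable L A _ [set w : (n + n).-tuple nat |
    exists2 uv, E uv & w = cat_tuple uv.1 uv.2].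
    move=> g /aut_fun_ex[h <-] _ [[u v] [k [/= ku kv]] ->].
    exists (tact (aut_fun h) u, tact (aut_fun h) v).
      by exists (F h k); split; exact: Cact.
    by apply: val_inj; rewrite /= map_cat.
  exists phi; apply/seteqP; split=> -[u v] /=.
    move=> uv; suff: [set v | sat A phi v] (cat_tuple u v) by [].
    by rewrite -phiE; exists (u, v).
  move=> uv; have : [set v | sat A phi v] (cat_tuple u v) by [].
  rewrite -phiE => -[[u' v'] uv' /(congr1 val) /= /eqP].
  rewrite eqseq_cat ?size_tuple // => /andP[/eqP uu' /eqP vv'].
  by rewrite (val_inj uu') (val_inj vv').
- split.
  + by move=> [u v] [k [[g /= -> _] [h /= -> _]]]; split; [exists g | exists h].
  + by move=> _ [g ->]; exists (F g 0).
  + by move=> u v [k []]; exists k.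
  + move=> u v w [k [/= ku kv]] [k' [/= /(C_inj _ _ _ kv) <- kw]].
    by exists k.
- rewrite KE; apply/infiniteP.
  have /card_eqPle[_ //] : (range C #= [set: nat])%card.
  by apply: inj_card_eq => x y _ _; exact: Csetinj.
(* The bijection [c] from [nat] to the classes turns [h] into a permutation of [nat], whose preimage
   under [Phi] is the automorphism wanted. *)
- rewrite KE => h [h' hK h'K].
  have Ck k : range C (C k) by exists k.
  pose c k : set_type (range C) := exist _ (C k) (mem_set (Ck k)).
  have /choice[c' c'P] (X : set_type (range C)) : exists k, c k = X.
    by have [k _ kX] := set_valP X; exists k; exact: val_inj.
  have c'K k : c' (c k) = k by apply: Csetinj; have /(congr1 val) := c'P (c k).
  have pb : bijective (c' \o h \o c).
    by exists (c' \o h' \o c) => k /=; rewrite c'P ?hK ?h'K c'K.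
  pose g := Psi (mkSinf pb).
  have hc k : val (h (c k)) = C (F g k).
    by rewrite /F /g PsiK /= -[LHS]/(val (h (c k))) -{1}[h (c k)]c'P.
  exists (\val g); first exact: aut_funP.
  move=> X; rewrite -(c'P X); move: (c' X) => k; rewrite [RHS]hc.
  apply/seteqP; split=> v.
    by move=> [u ku <-]; exact: Cact.
  move=> kv; exists (tact (aut_fun g^-1%g) v).
    have := Cact g^-1%g _ _ kv; rewrite -PhiM mulVg /F Phi1; exact.
  by rewrite -tact_comp aut_funKV tact_id.
(* An automorphism of the expansion preserves each [C k], so [Phi] sends it to [1] and it is
   trivial; hence every singleton is invariant. *)
- rewrite KE => x; apply: invariant_definable => g /expansion_automorphism.
  move=> [/aut_fun_ex[h <-] hC] _ ->.
  have -> : h = 1%g.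
    apply: (can_inj PhiK); rewrite Phi1; apply/sinf_inj/funext => k.
    have [g' g'k] := C_ex k.
    apply: (C_inj _ _ (tact (aut_fun h) (orb g'))).
      by rewrite -g'k; exact: Cact.
    have Ck : range C (C k) by exists k.
    by apply/(hC _ Ck (orb g')); rewrite -g'k; exact: Corb.
  by rewrite aut_fun1 tact_id.
Qed.

(** * From indiscernible classes to an isomorphism *)

(** Definability makes both [g] and [g^-1] preserve [E], which gives the two inclusions. *)
Lemma tact_class (L : signature) (A : structure L) n (D : set (n.-tuple nat))
    (E : set (n.-tuple nat * n.-tuple nat)) (g : AutGroup A) C :
  definable_set A D -> definable_rel A E -> eqv_classes D E C ->
  eqv_classes D E [set tact (aut_fun g) v | v in C].
Proof.
move=> Ddef [phi Ephi] [u Du ->]; exists (tact (aut_fun g) u).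
  by apply/(definable_invariant u Ddef (aut_funP g)).
have EE (h : AutGroup A) v w :
    E (v, w) -> E (tact (aut_fun h) v, tact (aut_fun h) w).
  rewrite Ephi /= => /(sat_aut phi _ (aut_funP h)); congr sat.
  by apply: val_inj; rewrite /= map_cat.
apply/seteqP; split=> v /= => [[w uw <-]|]; first exact: EE.
move=> /(EE g^-1%g); rewrite -tact_comp aut_funVK tact_id => uv.
by exists (tact (aut_fun g^-1%g) v); rewrite // -tact_comp aut_funKV tact_id.
Qed.

Lemma indiscernible_iso_Sinf (L : signature) (A : structure L) n
    (D : set (n.-tuple nat)) (E : set (n.-tuple nat * n.-tuple nat)) :
  definable_set A D -> definable_rel A E -> equivalence_on D E ->
  infinite_set (eqv_classes D E) ->
  absolutely_indiscernible A (eqv_classes D E) ->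
  (forall a : nat, definable_elt (expansion A (eqv_classes D E)) a) ->
  exists Phi : {multiplicative AutGroup A -> Sinf},
     bijective Phi /\ continuous Phi.
Proof.
move=> Ddef Edef Eeqv Kinf Kind Adef; set K := eqv_classes D E.
have Kcnt : countable K.
  pose cl u := [set v | E (u, v)].
  apply: (@sub_countable _ _ _ (cl @` D)); last first.
    by apply: (@sub_countable _ _ _ D) => //; exact: card_image_le.
  by apply: subset_card_le => _ [u Du ->]; exists u.
have [e [e' eK e'K]] := infinite_countable_bij Kcnt Kinf.
have Ke C : K C -> exists k, C = val (e k).
  move=> KC; pose X : set_type K := SigSub (mem_set KC).
  by exists (e' X); rewrite e'K.
have /choice[Fpair FpairP] (gk : AutGroup A * nat) : exists j,
    [set tact (aut_fun gk.1) v | v in val (e gk.2)] = val (e j).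
  exact/Ke/(tact_class gk.1 Ddef Edef (set_valP (e gk.2))).
pose F g k := Fpair (g, k).
have FP g k : [set tact (aut_fun g) v | v in val (e k)] = val (e (F g k)).
  exact: (FpairP (g, k)).
have e_inj : injective (val \o e).
  by move=> j k /val_inj /(can_inj eK).
have FM g h : F (g * h)%g = F g \o F h.
  apply/funext => k; apply: e_inj; rewrite /= -!FP aut_funM image_comp.
  by congr image; apply/funext => v; rewrite /= tact_comp.
have F1 : F 1%g = id.
  apply/funext => k; apply: e_inj; rewrite /= -FP aut_fun1.
  by under eq_imagel do rewrite tact_id; rewrite image_id.
have Fb g : bijective (F g).
  exists (F g^-1%g) => k; rewrite -[LHS]/((F _ \o F _) k) -FM.
    by rewrite mulVg F1.
  by rewrite mulgV F1.
have [|Phi PhiE] := @morph_multiplicative (AutGroup A) Sinf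
    (fun g => mkSinf (Fb g)).
  by move=> g h; apply: sinf_inj; exact: FM.
have PhiF g : sinf_fun (Phi g) = F g by rewrite PhiE.
(* Distinct classes are disjoint, so one common tuple identifies an index. *)
have class_meet k j v : val (e k) v -> val (e j) v -> k = j.
  have [_ EV Es Et] := Eeqv.
  have [u Du ku] := set_valP (e k); have [w Dw jw] := set_valP (e j).
  rewrite ku jw /= => uv wv; apply: e_inj; rewrite /comp ku jw.
  apply/seteqP; split=> x /= ux.
    by apply: (Et _ v) => //; apply: (Et _ u) => //; exact: Es.
  by apply: (Et _ v) => //; apply: (Et _ w) => //; exact: Es.
have rep k : exists v, val (e k) v.
  have [u Du ku] := set_valP (e k); exists u.
  by rewrite ku; exact: (eqv_refl Eeqv).
(* If [g] and [h] act alike on the classes, [h^-1 * g] is an automorphism of the expansion and fixes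
   its definable elements, that is, all elements. *)
have Phi_inj : injective Phi.
  move=> g h gh.
  have Fgh : F (h^-1 * g)%g = id.
    by rewrite FM -(PhiF g) gh PhiF -FM mulVg F1.
  rewrite -[g](mulVKg h) (_ : (h^-1 * g)%g = 1%g) ?mulg1 //.
  apply: aut_fun_inj; apply/funext => a.
  apply: (definable_elt_fixed (Adef a)); apply/expansion_automorphism.
  split; first exact: aut_funP.
  move=> C KC v; have [k Ck] := Ke C KC.
  have gC : [set tact (aut_fun (h^-1 * g)%g) v | v in C] = C.
    by rewrite Ck FP Fgh.
  split=> [Cv|]; first by rewrite -gC; exists v.
  rewrite -{1}gC => -[w Cw /(tact_inj (bij_inj (sinf_bij _)))].
  by move=> <-.
have Phi_surj (p : Sinf) : exists g, Phi g = p.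
  have [p' pK p'K] := sinf_bij p.
  (* The enumeration [e] transports [p] to a permutation of the classes. *)
  have [|g gA gext] := Kind (e \o p \o e').
    by exists (e \o p' \o e') => C /=; rewrite eK ?pK ?p'K e'K.
  have [h hg] := aut_fun_ex gA; exists h => //.
  apply/sinf_inj; rewrite PhiF; apply/funext => k; apply: e_inj.
  by rewrite /= -FP hg [LHS]gext /= eK.
exists Phi; split.
  have [Psi PsiK] := choice Phi_surj.
  by exists Psi => // g; apply: Phi_inj; rewrite PsiK.
move=> g U /nbhs_Sinf[m mU]; apply/nbhs_AutGroup.
have [r rP] := choice rep.
(* The bound exceeds every entry of the representatives [r k] for [k < m]. Automorphisms agreeing
   below it move [r k] to the same tuple, hence its class to the same class. *)
exists (\max_(k < m) \max_(i < n) (tnth (r k) i).+1) => h hg.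
apply: mU => k km; rewrite !PhiF.
apply: (class_meet _ _ (tact (aut_fun g) (r k))); last first.
  by rewrite -FP; exists (r k).
rewrite -FP; exists (r k) => //; apply: eq_from_tnth => i; rewrite !tnth_map.
apply: hg; apply: leq_trans (leq_bigmax (Ordinal km)).
exact: (leq_bigmax (F := fun i => (tnth (r k) i).+1)).
Qed.

Theorem theorem4p2 (L : signature) (A : structure L) :
  (exists Phi : {multiplicative AutGroup A -> Sinf},
     bijective Phi /\ continuous Phi)
  <->
  (exists (n : nat) (D : set (n.-tuple nat))
          (E : set (n.-tuple nat * n.-tuple nat)),
     [/\ definable_set A D, definable_rel A E, equivalence_on D E &
         infinite_set (eqv_classes D E)] /\
     absolutely_indiscernible A (eqv_classes D E) /\
     (forall a : nat, definable_elt (expansion A (eqv_classes D E)) a)).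
Proof.
split=> [[Phi [Phib Phic]]|[n [D [E [[Ddef Edef Eeqv Kinf] [Kind Adef]]]]]].
  exact: iso_Sinf_indiscernible Phib Phic.
exact: indiscernible_iso_Sinf Adef.
Qed.
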